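(* Let $p>1$. If $G$ is a graph of order $n$ with clique number $\omega$, then $\lambda^{(p)}(G)<\lambda^{(p)}(T_\omega(n))$, unless $G=T_\omega(n)$.
   Context: For a graph $G$ with vertex set $\{1,\dots,n\}$ and real $p\geq1$, the $p$-spectral radius is $\lambda^{(p)}(G)=\max\{2\sum_{\{i,j\}\in E(G)}x_ix_j : x_1,\dots,x_n\in\mathbb{R},\ |x_1|^p+\cdots+|x_n|^p=1\}$. $T_k(n)$ denotes the Turán graph: the complete $k$-partite graph of order $n$ whose parts have sizes $\lfloor n/k\rfloor$ or $\lceil n/k\rceil$. The clique number is the largest order of a complete subgraph. *)

(* Defs.v *)
From mathcomp Require Import all_boot all_order all_algebra all_fingroup.
From mathcomp Require Import all_classical all_reals all_analysis.

Set Implicit Arguments.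
Unset Strict Implicit.
Unset Printing Implicit Defensive.

Import Order.TTheory GRing.Theory Num.Theory.
Import numFieldNormedType.Exports.

Local Open Scope classical_set_scope.
Local Open Scope ring_scope.

Record sgraph (n : nat) := SGraph {
  adj :> rel 'I_n;
  adj_sym : symmetric adj;
  adj_irrefl : irreflexive adj }.

Definition isomorphic (n : nat) (G H : sgraph n) : Prop :=
  exists s : 'S_n, forall i j : 'I_n, G i j = H (s i) (s j).

Definition clique (n : nat) (G : sgraph n) (A : {set 'I_n}) : bool :=
  [forall i in A, forall j in A, (i != j) ==> G i j].

Definition clique_number (n : nat) (G : sgraph n) : nat :=
  (\max_(A : {set 'I_n} | clique G A) #|A|)%N.

(* The parts are the residue classes mod k; [turan_part_size] checks their
   sizes.  Only k > 0 is meaningful. *)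
Definition turan_adj (k n : nat) : rel 'I_n :=
  fun i j => (i %% k)%N != (j %% k)%N.

Lemma turan_adj_sym (k n : nat) : symmetric (@turan_adj k n).
Proof. by move=> i j; rewrite /turan_adj eq_sym. Qed.

Lemma turan_adj_irrefl (k n : nat) : irreflexive (@turan_adj k n).
Proof. by move=> i; rewrite /turan_adj eqxx. Qed.

Definition turan (k n : nat) : sgraph n :=
  SGraph (@turan_adj_sym k n) (@turan_adj_irrefl k n).

Lemma turan_part_size (k n c : nat) : (c < k)%N ->
  #|[pred i : 'I_n | (i %% k)%N == c]| = (n %/ k + (c < n %% k))%N.
Proof.
move=> ck; have k0 : (0 < k)%N by exact: leq_ltn_trans ck.
have -> : #|[pred i : 'I_n | (i %% k)%N == c]| =
    (\sum_(0 <= i < n) ((i %% k)%N == c))%N.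
  by rewrite big_mkord -sum1_card big_mkcond; apply: eq_bigr => i _; rewrite inE; case: eqP.
elim: n => [|n IH]; first by rewrite big_nil div0n mod0n.
rewrite big_nat_recr //= IH.
have [q [r [rk ->]]] : exists q r, (r < k)%N /\ n = (q * k + r)%N.
  by exists (n %/ k)%N, (n %% k)%N; rewrite ltn_pmod // -divn_eq.
rewrite -addnS !divnMDl // !modnMDl (divn_small rk) (modn_small rk).
move: (rk); rewrite leq_eqVlt => /orP[/eqP rk1|rk1].
  rewrite rk1 divnn k0 modnn ltn0; move: ck; rewrite -rk1 ltnS.
  by case: ltngtP => //; rewrite !addn0.
rewrite (divn_small rk1) (modn_small rk1) ltnS.
by case: ltngtP => //; rewrite !addn0.
Qed.

Definition psphere (R : realType) (n : nat) (p : R) : set 'rV[R]_n :=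
  [set x | \sum_(i < n) `|x 0 i| `^ p = 1].

Definition edge_form (R : realType) (n : nat) (G : sgraph n) (x : 'rV[R]_n) : R :=
  2 * \sum_(i < n) \sum_(j < n | (i < j)%N && G i j) x 0 i * x 0 j.

(* The supremum is a maximum for n > 0: see [pspectral_radius_max]. *)
Definition pspectral_radius (R : realType) (n : nat) (p : R) (G : sgraph n) : R :=
  sup (edge_form G @` psphere p).

Lemma continuous_norm_powR (R : realType) (p : R) : 0 < p ->
  continuous (fun t : R => `|t| `^ p).
Proof.
move=> p0 t; have [->|t0] := eqVneq t 0.
  apply/cvgrPdist_lt => e e0.
  have d0 : 0 < e `^ p^-1 by exact: powR_gt0.
  have : \forall u \near (0 : R), `|u| < e `^ p^-1.
    exact: pseudometric_normed_Zmodule.nbhs0_lt.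
  apply: filterS => u ud.
  rewrite normr0 powR0 ?gt_eqF // sub0r normrN ger0_norm ?powR_ge0 //.
  have -> : e = (e `^ p^-1) `^ p.
    by rewrite -powRrM mulVf ?gt_eqF // powRr1 // ltW.
  by apply: gt0_ltr_powR => //; rewrite nnegrE ?powR_ge0 ?normr_ge0.
have h : \near t, expR (p * ln `|t|) = `|t| `^ p.
  have : \forall u \near t, u != 0
    by apply: open_nbhs_nbhs; split=> //; exact: open_neq.
  by apply: filterS => u u0; rewrite /powR normr_eq0 ifN.
apply: (cvg_trans (near_eq_cvg h)).
rewrite /powR normr_eq0 ifN //.
apply: (@continuous_comp _ _ _ (fun u => p * ln `|u|) expR);
  last exact: continuous_expR.
apply: cvgM; first exact: cvg_cst.
apply: (@continuous_comp R R R (fun u : R => `|u|) (@ln R) t).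
  exact: norm_continuous.
by apply: continuous_ln; rewrite normr_gt0.
Qed.

Lemma psphere_nonempty (R : realType) (n : nat) (p : R) :
  (0 < n)%N -> 0 < p -> @psphere R n p !=set0.
Proof.
case: n => // n _ p0; exists (delta_mx 0 0).
rewrite /psphere /= (bigD1 ord0) //= big1 => [|i /negbTE i0].
  by rewrite mxE !eqxx normr1 powR1 addr0.
by rewrite mxE eqxx i0 normr0 powR0 ?gt_eqF.
Qed.

Lemma continuous_sumr (T : topologicalType) (R : realType) (I : Type)
    (r : seq I) (P : pred I) (F : I -> T -> R) :
  (forall i, P i -> continuous (F i)) ->
  continuous (fun x => \sum_(i <- r | P i) F i x).
Proof.
move=> cF x.
apply: (@cvg_big R I +%R 0 P _ T (nbhs x) r F (F^~ x)) => [|i Pi].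
  exact: pseudometric_normed_Zmodule.add_continuous.
exact: cF.
Qed.

Lemma psphere_compact (R : realType) (n : nat) (p : R) :
  0 < p -> compact (@psphere R n p).
Proof.
move=> p0.
pose B := `[(-1 : R), 1]%classic.
have cB : compact [set x : 'rV[R]_n | forall i, B (x ord0 i)].
  by apply: (@rV_compact R n (fun=> B)) => i; exact: segment_compact.
apply: (subclosed_compact _ cB).
  rewrite (_ : psphere p =
      (fun x : 'rV[R]_n => \sum_(i < n) `|x 0 i| `^ p) @^-1` [set 1]) //.
  apply: closed_comp; last exact: closed_eq.
  move=> x _; apply: continuous_sumr => i _ {}x.
  apply: (@continuous_comp 'rV[R]_n R R (fun x => x ord0 i)
    (fun t => `|t| `^ p) x).
    exact: coord_continuous.
  exact: continuous_norm_powR.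
move=> x /= xS i; rewrite /B /= in_itv /= -ler_norml leNgt; apply/negP => xi.
have : 1 < `|x 0 i| `^ p.
  by have := gt0_ltr_powR p0 _ _ xi; rewrite powR1 => -> //;
    rewrite nnegrE ?normr_ge0.
rewrite ltNge -[leRHS]xS (bigD1 i) //= lerDl.
by rewrite sumr_ge0 // => j _; exact: powR_ge0.
Qed.

Lemma edge_form_continuous (R : realType) (n : nat) (G : sgraph n) :
  continuous (@edge_form R n G).
Proof.
have cs : continuous (fun x : 'rV[R]_n =>
    \sum_(i < n) \sum_(j < n | (i < j)%N && G i j) x 0 i * x 0 j).
  apply: continuous_sumr => i _; apply: continuous_sumr => j _ x.
  by apply: (@cvgM _ _ (nbhs x)); exact: coord_continuous.
by move=> x; apply: (@cvgMl_tmp _ _ (nbhs x)); exact: cs.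
Qed.

Lemma pspectral_radius_max (R : realType) (n : nat) (p : R) (G : sgraph n) :
  (0 < n)%N -> 0 < p ->
  (exists2 x, psphere p x & edge_form G x = pspectral_radius p G) /\
  (forall x, psphere p x -> edge_form G x <= pspectral_radius p G).
Proof.
move=> n0 p0.
have [|c /set_mem cS cmax] := compact_EVT_max (psphere_nonempty n0 p0)
    (psphere_compact p0) (f := @edge_form R n G).
  exact/continuous_subspaceT/edge_form_continuous.
have ub : ubound (edge_form G @` psphere p) (edge_form G c).
  by move=> _ [x xS <-]; apply: cmax; exact/mem_set.
have -> : pspectral_radius p G = edge_form G c.
  apply/eqP; rewrite eq_le ge_sup //=; last by exists (edge_form G c), c.
  by apply: ub_le_sup; [exists (edge_form G c)|exists c].
by split; [exists c|move=> x xS; apply: ub; exists x].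
Qed.

(* Main.v *)
(* A nonnegative maximiser [x] for [G] is also a weighting of the vertices of every
   other graph.  Erdős's degree majorization (make the non-neighbours of a vertex of
   largest weighted degree into one part, and recurse on its neighbourhood) yields a
   complete multipartite graph with at most omega parts whose form at [x] is at least
   that of [G], with equality for positive [x] only if it is [G].
   Now maximise jointly over all omega-colourings and all weightings of unit p-mass:
   since p > 1, tangent lines of t |-> t^p show that a joint maximiser is positive and
   that its colouring is balanced, so that its graph is the Turán graph. *)
Require Import Defs.
From mathcomp Require Import all_boot all_order all_algebra all_fingroup.
From mathcomp Require Import all_classical all_reals all_analysis.
From mathcomp Require Import ring lra zify.

Set Implicit Arguments.
Unset Strict Implicit.

Import Order.TTheory GRing.Theory Num.Theory.
Local Open Scope ring_scope.

(** * Tangent lines of the power function *)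

Lemma powR_mulr_sub1 (R : realType) (p u : R) : 1 < p -> 0 <= u -> u `^ p = u * u `^ (p - 1).
Proof.
move=> p1 u0; rewrite -{2}[u]powRr1 // -powRD; first by congr (_ `^ _); ring.
by apply/implyP; lra.
Qed.

(* With [z = ln (t / u)] and after division by [u `^ p * expR z] this reads
   [p < expR ((p - 1) * z) + (p - 1) * expR (- z)], which is [1 + y < expR y] twice. *)
Lemma powR_tangent_lt (R : realType) (p t u : R) :
  1 < p -> 0 <= t -> 0 <= u -> t != u ->
  p * t * u `^ (p - 1) < t `^ p + (p - 1) * u `^ p.
Proof.
move=> p1 t0 u0 tu; have p0 : 0 < p by lra.
have [u00|un0] := eqVneq u 0.
  rewrite u00 !powR0 ?gt_eqF ?subr_gt0 // !mulr0 addr0 powR_gt0 //.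
  by rewrite lt_neqAle t0 eq_sym -u00 tu.
have up : 0 < u by rewrite lt_neqAle eq_sym un0.
have [t00|tn0] := eqVneq t 0.
  by rewrite t00 mulr0 mul0r powR0 ?gt_eqF // add0r mulr_gt0 ?powR_gt0 ?subr_gt0.
have tp : 0 < t by rewrite lt_neqAle eq_sym tn0.
pose z := ln t - ln u.
have tE : t = u * expR z by rewrite /z expRB !lnK ?posrE // mulrCA divff ?mulr1.
have z0 : z != 0 by apply: contra tu => /eqP z0; rewrite tE z0 expR0 mulr1.
have tpE : t `^ p = u `^ p * (expR z * expR ((p - 1) * z)).
  rewrite tE powRM ?expR_ge0 // -expRM -expRD; congr (_ * expR _); ring.
have uE := powR_mulr_sub1 p1 u0.
have e1 : 1 + (p - 1) * z < expR ((p - 1) * z).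
  by apply: expR_gt1Dx; rewrite mulf_neq0 // subr_eq0 gt_eqF.
have e2 : 1 + - z < expR (- z) by apply: expR_gt1Dx; rewrite oppr_eq0.
have ee : expR z * expR (- z) = 1 by rewrite expRxMexpNx_1.
have key : p < expR ((p - 1) * z) + (p - 1) * expR (- z).
  have : (p - 1) * (1 + - z) < (p - 1) * expR (- z) by rewrite ltr_pM2l // subr_gt0.
  by lra.
have -> : t `^ p + (p - 1) * u `^ p
    = u `^ p * expR z * (expR ((p - 1) * z) + (p - 1) * expR (- z)).
  transitivity (u `^ p * (expR z * expR ((p - 1) * z))
      + (p - 1) * u `^ p * (expR z * expR (- z))); last by ring.
    by rewrite tpE ee mulr1.
have -> : p * t * u `^ (p - 1) = u `^ p * expR z * p by rewrite uE tE; ring.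
by rewrite ltr_pM2l // mulr_gt0 ?powR_gt0 ?expR_gt0.
Qed.

Lemma powR_tangent_le (R : realType) (p t u : R) :
  1 < p -> 0 <= t -> 0 <= u ->
  p * t * u `^ (p - 1) <= t `^ p + (p - 1) * u `^ p.
Proof.
move=> p1 t0 u0; have [->|/powR_tangent_lt h] := eqVneq t u; last exact/ltW/h.
by rewrite (powR_mulr_sub1 p1 u0) le_eqVlt; apply/orP; left; apply/eqP; ring.
Qed.

(** * Edge form and p-mass: homogeneity, absolute values, isomorphism *)

Section GraphForms.
Context {R : realType} {n : nat}.
Implicit Types (G H : sgraph n) (x y : 'rV[R]_n).

Definition pmass (p : R) x : R := \sum_(i < n) `|x 0 i| `^ p.

(** The factor 2 lets each edge be counted once in each order; the second copy of the sum is
    reindexed by swapping [i] and [j]. *)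
Lemma edge_formE G x :
  edge_form G x = \sum_i \sum_(j | G i j) x 0 i * x 0 j.
Proof.
rewrite /edge_form mulr_natl mulr2n.
rewrite [X in X + _ = _](_ : _ = \sum_i \sum_(j | G i j && (i < j)%N) x 0 i * x 0 j); last first.
  by apply: eq_bigr => i _; apply: eq_bigl => j; rewrite andbC.
rewrite [X in _ + X = _](_ : _ = \sum_i \sum_(j | G i j && ~~ (i < j)%N) x 0 i * x 0 j).
  by rewrite -big_split; apply: eq_bigr => i _; rewrite [RHS](bigID (fun j : 'I_n => (i < j)%N)).
rewrite (exchange_big_dep predT) //=; apply: eq_bigr => j _.
apply: eq_big => [i|i _]; last by rewrite mulrC.
rewrite adj_sym andbC -leqNgt; case Gij: (G j i) => //=.
rewrite ltn_neqAle (_ : (i : nat) != j = true) //; apply: contraTneq Gij => /val_inj ->.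
by rewrite adj_irrefl.
Qed.

Lemma pmass_ge0 p x : 0 <= pmass p x.
Proof. by apply: sumr_ge0 => i _; exact: powR_ge0. Qed.

Lemma edge_formZ G (a : R) x : edge_form G (a *: x) = a ^+ 2 * edge_form G x.
Proof.
rewrite !edge_formE big_distrr; apply: eq_bigr => i _ /=.
rewrite big_distrr; apply: eq_bigr => j _ /=; rewrite !mxE; ring.
Qed.

Lemma pmassZ p (a : R) x : 0 <= a -> pmass p (a *: x) = a `^ p * pmass p x.
Proof.
move=> a0; rewrite /pmass big_distrr; apply: eq_bigr => i _ /=.
by rewrite !mxE normrM powRM ?normr_ge0 // ger0_norm.
Qed.

Lemma edge_form_abs G x :
  edge_form G x <= edge_form G (\row_i `|x 0 i|).
Proof.
rewrite !edge_formE; apply: ler_sum => i _; apply: ler_sum => j _.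
by rewrite !mxE -normrM ler_norm.
Qed.

Lemma pmass_abs p x : pmass p (\row_i `|x 0 i|) = pmass p x.
Proof. by apply: eq_bigr => i _; rewrite mxE normr_id. Qed.

Lemma pmass_eq0 p x : 0 < p -> pmass p x = 0 -> x = 0.
Proof.
move=> p0 /eqP; rewrite psumr_eq0 => [/allP x0|i _]; last exact: powR_ge0.
apply/rowP => i; rewrite mxE; apply/eqP; rewrite -normr_eq0.
by have := x0 i (mem_index_enum _); rewrite powR_eq0 (gt_eqF p0) andbT.
Qed.

Section Radius.
Variable p : R.
Hypotheses (n0 : (0 < n)%N) (p0 : 0 < p).

(** The form has degree 2 and the p-mass degree [p], so a nonzero [x] can be scaled by [a] onto the
    sphere; zero p-mass means [x = 0]. *)
Lemma edge_form_le_pspectral G x :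
  edge_form G x <= pspectral_radius p G * (pmass p x) `^ (2 / p).
Proof.
have [m0|m0] := eqVneq (pmass p x) 0.
  rewrite m0 powR0 ?mulr0; last by rewrite mulf_neq0 ?invr_eq0 ?gt_eqF.
  rewrite (pmass_eq0 p0 m0) edge_formE big1 // => i _.
  by rewrite big1 // => j _; rewrite mxE mul0r.
have mp : 0 < pmass p x by rewrite lt_neqAle eq_sym m0 pmass_ge0.
set a := (pmass p x) `^ (- p^-1).
have ap : 0 < a by exact: powR_gt0.
have aM : a ^+ 2 * (pmass p x) `^ (2 / p) = 1.
  rewrite -powR_mulrn ?ltW // /a -powRrM -powRD ?m0 ?implybT //.
  by rewrite [X in _ `^ X](_ : _ = 0) ?powRr0 //; ring.
have h : edge_form G (a *: x) <= pspectral_radius p G.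
  apply: (pspectral_radius_max G n0 p0).2.
  rewrite /psphere /= -/(pmass p _) pmassZ ?ltW // /a -powRrM mulNr mulVf ?gt_eqF //.
  by rewrite powR_inv1 ?ltW // mulVf.
rewrite edge_formZ in h.
rewrite -[leLHS]mul1r -{1}aM mulrAC ler_wpM2r ?powR_ge0 //.
Qed.

Lemma pspectral_radius_ge0 G : 0 <= pspectral_radius p G.
Proof.
pose x : 'rV[R]_n := delta_mx 0 (Ordinal n0).
have : psphere p x.
  rewrite /psphere /= (bigD1 (Ordinal n0)) //= big1 => [|i /negbTE i0].
    by rewrite mxE !eqxx normr1 powR1 addr0.
  by rewrite mxE eqxx i0 normr0 powR0 ?gt_eqF.
move=> /((pspectral_radius_max G n0 p0).2 x); apply: le_trans.
rewrite edge_formE; apply: sumr_ge0 => i _; apply: sumr_ge0 => j _.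
by rewrite !mxE mulr_ge0 ?ler0n.
Qed.

Lemma edge_form_le_of_pmass_le1 G x :
  pmass p x <= 1 -> edge_form G x <= pspectral_radius p G.
Proof.
move=> m1; apply: le_trans (edge_form_le_pspectral G x) _.
rewrite ler_piMr ?pspectral_radius_ge0 // -[leRHS](congr1 (@^~ (2 / p)) (powR1 R)).
by rewrite ge0_ler_powR ?nnegrE ?pmass_ge0 // divr_ge0 // ltW.
Qed.

Lemma edge_form_lt_of_pmass_lt1 G x :
  0 < edge_form G x -> pmass p x < 1 -> edge_form G x < pspectral_radius p G.
Proof.
move=> f0 m1; have h := edge_form_le_pspectral G x.
have pos : 0 < pspectral_radius p G.
  rewrite lt_neqAle pspectral_radius_ge0 andbT eq_sym; apply/eqP => e.
  by move: h; rewrite e mul0r leNgt f0.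
apply: le_lt_trans h _; rewrite gtr_pMr // -[ltRHS](congr1 (@^~ (2 / p)) (powR1 R)).
by rewrite gt0_ltr_powR ?nnegrE ?pmass_ge0 // divr_gt0.
Qed.

Lemma pspectral_radius_gt0 G (i j : 'I_n) : G i j -> 0 < pspectral_radius p G.
Proof.
move=> Gij; pose x : 'rV[R]_n := const_mx 1.
have f0 : 0 < edge_form G x.
  rewrite edge_formE (bigD1 i) //= ltr_pwDl //.
    by rewrite (bigD1 j) //= !mxE ltr_pwDl ?mul1r ?ltr01 // sumr_ge0 // => k _; rewrite !mxE mul1r.
  by apply: sumr_ge0 => k _; apply: sumr_ge0 => l _; rewrite !mxE mul1r.
rewrite lt_neqAle pspectral_radius_ge0 andbT eq_sym; apply/eqP => e.
by have := edge_form_le_pspectral G x; rewrite e mul0r leNgt f0.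
Qed.

(** Absolute values keep the p-mass of a maximiser and do not lower its form. *)
Lemma pspectral_radius_nonneg_max G :
  exists x, [/\ forall i, 0 <= x 0 i, pmass p x = 1 &
    edge_form G x = pspectral_radius p G].
Proof.
have [[x xS xM] _] := pspectral_radius_max G n0 p0.
have xm : pmass p (\row_i `|x 0 i|) = 1 by rewrite pmass_abs.
exists (\row_i `|x 0 i|); split=> //; first by move=> i; rewrite mxE.
apply/eqP; rewrite eq_le -{2}xM edge_form_abs andbT.
by apply: edge_form_le_of_pmass_le1; rewrite xm.
Qed.

Lemma isomorphic_pspectral_radius_le G H :
  isomorphic G H -> pspectral_radius p G <= pspectral_radius p H.
Proof.
move=> [s sGH]; have [x [x0 xm <-]] := pspectral_radius_nonneg_max G.
have -> : edge_form G x = edge_form H (\row_i x 0 ((s^-1)%g i)).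
  rewrite !edge_formE [RHS](reindex_inj (@perm_inj _ s)); apply: eq_bigr => i _ /=.
  rewrite [RHS](reindex_inj (@perm_inj _ s)); apply: eq_big => [j|j _] /=; first exact: sGH.
  by rewrite !mxE !permK.
apply: edge_form_le_of_pmass_le1; rewrite -xm /pmass.
rewrite (reindex_inj (@perm_inj _ s)) le_eqVlt; apply/orP; left; apply/eqP.
by apply: eq_bigr => i _; rewrite mxE permK.
Qed.

End Radius.
End GraphForms.

(** * Complete multipartite graphs and balanced colourings *)

Section MultipartiteGraph.
Context {n : nat}.

(** The parts are the fibres of a colouring. Fibres may be empty, so the number of colours only
    bounds the number of parts. *)
Definition multipartite_adj {T : eqType} (c : 'I_n -> T) : rel 'I_n :=
  fun i j => c i != c j.

Lemma multipartite_adj_sym (T : eqType) (c : 'I_n -> T) : symmetric (multipartite_adj c).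
Proof. by move=> i j; rewrite /multipartite_adj eq_sym. Qed.

Lemma multipartite_adj_irrefl (T : eqType) (c : 'I_n -> T) : irreflexive (multipartite_adj c).
Proof. by move=> i; rewrite /multipartite_adj eqxx. Qed.

Definition multipartite {T : eqType} (c : 'I_n -> T) : sgraph n :=
  @SGraph n (multipartite_adj c) (multipartite_adj_sym c) (multipartite_adj_irrefl c).

End MultipartiteGraph.

(** Equal fibre sizes say that the two lists of values are rearrangements of each other. *)
Lemma perm_of_eq_fibers (m : nat) (T : eqType) (f g : 'I_m -> T) :
  (forall v, #|[pred i | f i == v]| = #|[pred i | g i == v]|) ->
  exists s : 'S_m, forall i, f i = g (s i).
Proof.
move=> fg; have /tuple_permP[s sP] : perm_eq [tuple f i | i < m] [tuple g i | i < m].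
  apply/allP => v _ /=; apply/eqP; rewrite !count_map -!enumT.
  by have := fg v; rewrite !cardE !size_filter !enumT /=.
exists s => i; have := congr1 (fun t => nth (f i) t i) sP.
by rewrite -!tnth_nth !tnth_mktuple.
Qed.

Definition balanced (k : nat) (f : 'I_k -> nat) := forall i j, (f i <= (f j).+1)%N.

(** Every value is the minimum [m] or [m.+1]. Since [m] is attained, the number [t] of values [m.+1]
    is below [k], so [m] and [t] are the quotient and remainder of the total by [k]. Thus the total
    determines the multiset of values. *)
Lemma balanced_fibers (k : nat) (f : 'I_k -> nat) (v : nat) :
  balanced f -> (0 < k)%N ->
  #|[pred i | f i == v]| =
  ((v == (\sum_i f i) %/ k) * (k - (\sum_i f i) %% k)
   + (v == ((\sum_i f i) %/ k).+1) * ((\sum_i f i) %% k))%N.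
Proof.
move=> fb k0; pose i0 := [arg min_(i < Ordinal k0) f i]; pose m := f i0.
have mle i : (m <= f i)%N by rewrite /m /i0; case: arg_minnP => // j _; apply.
pose t := #|[pred i | f i == m.+1]|.
have fE i : f i = (m + (f i == m.+1))%N.
  have := mle i; have := fb i i0; rewrite -/m; case: eqP; lia.
have sE : (\sum_i f i = m * k + t)%N.
  rewrite (eq_bigr _ (fun i _ => fE i)) big_split /= sum_nat_const card_ord mulnC.
  by rewrite /t -sum1_card [in RHS]big_mkcond.
have ct : (#|[pred i | f i == m]| + t = k)%N.
  transitivity #|'I_k|; last exact: card_ord.
  rewrite -(cardC [pred i | f i == m]) /t; congr (_ + _)%N.
  by apply: eq_card => i; rewrite !inE fE; case: (f i == m.+1); lia.
have tk : (t < k)%N.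
  have : (0 < #|[pred i | f i == m]|)%N by apply/card_gt0P; exists i0; rewrite inE.
  by move: ct; lia.
rewrite sE divnMDl // modnMDl (divn_small tk) (modn_small tk) addn0.
case: (eqVneq v m) => [->|vm].
  by rewrite mul1n (_ : (m == m.+1) = false) ?mul0n; lia.
case: (eqVneq v m.+1) => [->|vm1]; first by rewrite mul1n.
rewrite !mul0n; apply: eq_card0 => i; rewrite !inE fE.
by case: (f i == m.+1); apply/eqP; move/eqP: vm; move/eqP: vm1; lia.
Qed.

Lemma sum_fibers (n k : nat) (c : 'I_n -> 'I_k) :
  (\sum_(u < k) #|[pred i | c i == u]| = n)%N.
Proof.
transitivity #|'I_n|; last exact: card_ord.
rewrite -sum1_card (partition_big c predT) //=.
by apply: eq_bigr => u _; rewrite -sum1_card; apply: eq_bigl.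
Qed.

Lemma balanced_isomorphic_turan (n k : nat) (c : 'I_n -> 'I_k.+1) :
  balanced (fun u => #|[pred i | c i == u]|) ->
  isomorphic (multipartite c) (turan k.+1 n).
Proof.
move=> cb; pose d (i : 'I_n) : 'I_k.+1 := inord (i %% k.+1).
have dE i : (d i : nat) = (i %% k.+1)%N by rewrite inordK // ltn_pmod.
have dc u : #|[pred i | d i == u]| = (n %/ k.+1 + (u < n %% k.+1))%N.
  rewrite -turan_part_size //; apply: eq_card => i.
  by rewrite !inE -(inj_eq val_inj) /= -dE.
have db : balanced (fun u => #|[pred i | d i == u]|).
  by move=> u w; rewrite !dc; do 2 case: (_ < _)%N; lia.
(* Both families of class sizes are balanced with total [n], so they agree up to a permutation of
   the colours. Once colours are matched, the vertices can be matched class by class. *)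
have [s sP] : exists s : 'S_k.+1, forall u, #|[pred i | c i == u]| = #|[pred i | d i == s u]|.
  apply: (@perm_of_eq_fibers _ _ _ (fun u => #|[pred i | d i == u]|)) => v.
  by rewrite !balanced_fibers // !sum_fibers.
have [t tP] : exists t : 'S_n, forall i, s (c i) = d (t i).
  apply: perm_of_eq_fibers => u.
  rewrite -[u](permKV s) -sP; apply: eq_card => i.
  by rewrite !inE (inj_eq perm_inj).
exists t => i j /=.
by rewrite /multipartite_adj /turan_adj -!dE (inj_eq val_inj) -!tP (inj_eq perm_inj).
Qed.

(** * Cliques and weighted degree majorization *)

Lemma cliqueP (n : nat) (G : sgraph n) (A : {set 'I_n}) :
  reflect {in A &, forall i j, i != j -> G i j} (clique G A).
Proof.
apply: (iffP forall_inP) => [cl i j iA jA|cl i iA].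
  by have /forall_inP/(_ j jA)/implyP := cl i iA.
by apply/forall_inP => j jA; apply/implyP; exact: cl.
Qed.

(** Induction on the clique bound [r]. Adding [v] to a clique in its neighbourhood [N] gives a
    larger clique in [A], so the induction hypothesis colours [N] with colours below [r]; the rest
    [B] of [A], which contains [v], receives the new colour [r]. The form then grows by
    [(cNN - GNN) + 2 * D + GBB], a sum of nonnegative terms. *)
Lemma weighted_degree_majorization (R : realType) (n : nat) (G : sgraph n) (w : 'I_n -> R)
    (r : nat) (A : {set 'I_n}) :
  (forall i, 0 <= w i) ->
  (forall C : {set 'I_n}, C \subset A -> clique G C -> (#|C| <= r)%N) ->
  exists c : 'I_n -> nat,
  [/\ forall i, i \in A -> (c i < r)%N,
   \sum_(i in A) \sum_(j in A | G i j) w i * w j <=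
     \sum_(i in A) \sum_(j in A | c i != c j) w i * w j &
   (forall i, 0 < w i) ->
   \sum_(i in A) \sum_(j in A | c i != c j) w i * w j <=
     \sum_(i in A) \sum_(j in A | G i j) w i * w j ->
   forall i j, i \in A -> j \in A -> G i j = (c i != c j)].
Proof.
move=> w0; elim: r A => [|r IH] A cl.
  have A0 : A = finset.set0.
    apply/eqP; rewrite -finset.subset0; apply/fintype.subsetP => i iA.
    have : (#|[set i]%SET| <= 0)%N; last by rewrite cards1.
    apply: cl; rewrite ?finset.sub1set //; by apply/cliqueP => j k /set1P -> /set1P ->; rewrite eqxx.
  by exists (fun=> 0%N); split=> [i||_ _ i j]; rewrite A0 ?inE // !big_set0.
have [A0|[v0 v0A]] := finset.set_0Vmem A.
  by exists (fun=> 0%N); split=> [i||_ _ i j]; rewrite A0 ?inE // !big_set0.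
pose deg i := \sum_(j in A | G i j) w j.
pose v := [arg max_(v > v0 in A) deg v]%O.
have [vA vmax] : v \in A /\ forall u, u \in A -> deg u <= deg v.
  by rewrite /v; case: Order.TotalTheory.arg_maxP.
pose N := [set u in A | G v u]%SET; pose B := A :\: N.
have NA : N \subset A by apply/fintype.subsetP => u; rewrite inE => /andP[].
have [|c [cr cle ceq]] := IH N.
  move=> C CN Ccl; have vC : v \notin C.
    by apply/negP => /(fintype.subsetP CN); rewrite inE adj_irrefl andbF.
  suff : (#|(v |: C)%SET| <= r.+1)%N by rewrite cardsU1 vC.
  apply: cl; first by rewrite finset.subUset finset.sub1set vA (fintype.subset_trans CN NA).
  apply/cliqueP => i j /setU1P iC /setU1P jC ij; case: iC jC ij => [->|iC] [->|jC]; first by rewrite eqxx.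
  - by move/(fintype.subsetP CN): jC; rewrite inE => /andP[].
  - by move/(fintype.subsetP CN): iC; rewrite inE adj_sym => /andP[].
  by move/cliqueP: Ccl; apply.
pose c' u := if u \in N then c u else r.
have split (F : 'I_n -> R) : \sum_(i in A) F i = \sum_(i in N) F i + \sum_(i in B) F i.
  by rewrite (big_setID N) /= (finset.setIidPr NA).
have splitG (P : pred 'I_n) (F : 'I_n -> R) : \sum_(j in A | P j) F j =
    \sum_(j in N | P j) F j + \sum_(j in B | P j) F j.
  by rewrite !big_mkcondr split.
have BN u : u \in B -> (u \notin N) && (u \in A) by rewrite /B finset.inE.
pose wN := \sum_(j in N) w j.
have degv : deg v = wN.
  by rewrite /deg /wN; apply: eq_bigl => j; rewrite /N inE.
pose GNN := \sum_(i in N) \sum_(j in N | G i j) w i * w j.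
pose cNN := \sum_(i in N) \sum_(j in N | c i != c j) w i * w j.
pose GBB := \sum_(i in B) \sum_(j in B | G i j) w i * w j.
pose D := \sum_(i in B) w i * (wN - deg i).
(* The degree sum over [B] counts the pairs inside [B] once; doubling it to cover both mixed blocks
   counts them twice, hence [- GBB]. *)
have GE : \sum_(i in A) \sum_(j in A | G i j) w i * w j =
   GNN + 2 * \sum_(i in B) w i * deg i - GBB.
  rewrite split (eq_bigr _ (fun i _ => splitG (G i) _)) big_split /= -/GNN.
  have -> : \sum_(i in N) \sum_(j in B | G i j) w i * w j = 
    \sum_(i in B) \sum_(j in N | G i j) w i * w j.
    rewrite (exchange_big_dep (mem B)) /=; last by move=> i j _ /andP[].
    apply: eq_bigr => j jB; apply: eq_big => [i|i _]; last by rewrite mulrC.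
    by rewrite jB adj_sym.
  have BA : \sum_(i in B) \sum_(j in A | G i j) w i * w j = \sum_(i in B) w i * deg i.
    by apply: eq_bigr => i _; rewrite /deg big_distrr.
  have : \sum_(i in B) \sum_(j in A | G i j) w i * w j =
     \sum_(i in B) \sum_(j in N | G i j) w i * w j + GBB.
    by rewrite (eq_bigr _ (fun i _ => splitG (G i) _)) big_split.
  by rewrite BA => ->; ring.
have CE : \sum_(i in A) \sum_(j in A | c' i != c' j) w i * w j =
   cNN + 2 * \sum_(i in B) w i * wN.
  have cN i : i \in N -> c' i = c i by rewrite /c' => ->.
  have cB i : i \in B -> c' i = r by move=> /BN; rewrite /c' => /andP[/negbTE ->].
  rewrite split (eq_bigr _ (fun i _ => splitG (fun j => c' i != c' j) _)) big_split /=.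
  have -> : \sum_(i in N) \sum_(j in N | c' i != c' j) w i * w j = cNN.
    apply: eq_bigr => i iN; apply: eq_bigl => j; case jN: (j \in N) => //=.
    by rewrite !cN.
  have -> : \sum_(i in N) \sum_(j in B | c' i != c' j) w i * w j = \sum_(i in B) w i * wN.
    rewrite (exchange_big_dep (mem B)) /=; last by move=> i j _ /andP[].
    apply: eq_bigr => j jB; rewrite /wN big_distrr; apply: eq_big => [i|i _]; last by rewrite mulrC.
    rewrite jB /=; case iN: (i \in N) => //=.
    by rewrite (cN i) // (cB j) // ltn_eqF // cr.
  have -> : \sum_(i in B) \sum_(j in A | c' i != c' j) w i * w j = \sum_(i in B) w i * wN.
    apply: eq_bigr => i iB; rewrite splitG //= [X in _ + X]big1 ?addr0; last first.
      by move=> j /andP[jB]; rewrite !cB // eqxx.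
    rewrite /wN big_distrr; apply: eq_bigl => j; case jN: (j \in N) => //=.
    by rewrite (cN j) // (cB i) // eq_sym ltn_eqF // cr.
  by ring.
have DE : D = \sum_(i in B) w i * wN - \sum_(i in B) w i * deg i.
  by rewrite /D -sumrB; apply: eq_bigr => i _; rewrite mulrBr.
have Dterm i : i \in B -> 0 <= w i * (wN - deg i).
  by move=> /BN/andP[_ iA]; rewrite mulr_ge0 // subr_ge0 -degv vmax.
have D0 : 0 <= D by apply: sumr_ge0.
have GBBt i j : 0 <= w i * w j by rewrite mulr_ge0.
have GBB0 : 0 <= GBB by apply: sumr_ge0 => i _; apply: sumr_ge0.
have NN : GNN <= cNN by exact: cle.
exists c'; rewrite GE CE; split; [|lra|].
  by move=> i iA; rewrite /c'; case: ifP => // /cr/ltnW.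
(* Equality makes all three terms of the gain vanish. *)
move=> wp le; have NNeq : cNN <= GNN by lra.
have D00 : D = 0 by lra.
have GBB00 : GBB = 0 by lra.
have noB i j : i \in B -> j \in B -> G i j = false.
  move=> iB jB; apply/negP => Gij; move: GBB00; apply/eqP; rewrite gt_eqF //.
  rewrite /GBB (bigD1 i) //= ltr_pwDl //; last by apply: sumr_ge0 => k _; apply: sumr_ge0.
  by rewrite (bigD1 j) ?jB //= ltr_pwDl ?mulr_gt0 // sumr_ge0.
(* [D = 0] gives each vertex of [B] the full degree [wN]; having no neighbour in [B], it must be
   adjacent to all of [N]. *)
have fullB i j : i \in B -> j \in N -> G i j.
  move=> iB jN; have degi : deg i = wN.
    have := D00 => /eqP; rewrite psumr_eq0 // => /allP/(_ i (mem_index_enum _)).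
    by rewrite iB /= mulf_eq0 gt_eqF //= subr_eq0 => /eqP.
  apply: contra_eqT degi => /negbTE Gij; rewrite lt_eqF // /deg splitG //.
  rewrite [X in _ + X]big1 ?addr0; last by move=> k /andP[kB]; rewrite noB.
  rewrite /wN [ltRHS](bigID (G i)) /= ltrDl (bigD1 j) ?jN ?Gij //= ltr_pwDl //.
  by apply: sumr_ge0.
move=> i j iA jA; rewrite /c'.
have inB u : u \in A -> u \in N = false -> u \in B by move=> uA uN; rewrite /B inE uN uA.
case iN: (i \in N); case jN: (j \in N).
- exact: ceq.
- by rewrite ltn_eqF ?cr // adj_sym fullB // inB.
- by rewrite eq_sym ltn_eqF ?cr // fullB // inB.
- by rewrite eqxx noB // inB.
Qed.

(** * The multipartite form through its part sums *)

Section Multipartite.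
Context {R : realType} {n : nat} {T : finType}.
Implicit Types (c : 'I_n -> T) (x y : 'rV[R]_n).

Definition part_sum c x (k : T) : R := \sum_(i | c i == k) x 0 i.

(** All ordered pairs, minus those inside one part. The form therefore depends on the weighting only
    through the part sums. *)
Lemma edge_form_multipartite c x :
  edge_form (multipartite c) x = (\sum_k part_sum c x k) ^+ 2 - \sum_k part_sum c x k ^+ 2.
Proof.
have -> : \sum_k part_sum c x k = \sum_i x 0 i.
  by rewrite [RHS](partition_big c predT).
have -> : \sum_k part_sum c x k ^+ 2 = \sum_i x 0 i * part_sum c x (c i).
  rewrite [RHS](partition_big c predT) //=; apply: eq_bigr => k _.
  by rewrite expr2 {1}/part_sum big_distrl; apply: eq_bigr => i /eqP ->.
rewrite edge_formE expr2 big_distrl -sumrB; apply: eq_bigr => i _ /=.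
rewrite -big_distrr -mulrBr /=; congr (_ * _).
rewrite [in RHS](bigID (fun j => c j == c i)) /= addrAC subrr add0r.
by apply: eq_bigl => j; rewrite /multipartite_adj eq_sym.
Qed.

(** With [s + t] fixed, [- s^2 - t^2] varies only through [2 * s * t]. *)
Lemma edge_form_part_sum_exchange c c' x y (k l : T) : k != l ->
  (forall m, m != k -> m != l -> part_sum c' y m = part_sum c x m) ->
  part_sum c' y k + part_sum c' y l = part_sum c x k + part_sum c x l ->
  edge_form (multipartite c') y = edge_form (multipartite c) x
    + 2 * (part_sum c' y k * part_sum c' y l - part_sum c x k * part_sum c x l).
Proof.
move=> kl eqs eqkl; rewrite !edge_form_multipartite.
have spl (F : T -> R) : \sum_m F m = F k + F l + \sum_(m | (m != k) && (m != l)) F m.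
  by rewrite (bigD1 k) //= (bigD1 l) 1?eq_sym //= addrA.
have eqr (f : R -> R) : \sum_(m | (m != k) && (m != l)) f (part_sum c' y m) =
    \sum_(m | (m != k) && (m != l)) f (part_sum c x m).
  by apply: eq_bigr => m /andP[mk ml]; rewrite eqs.
rewrite !spl (eqr id) (eqr (fun r => r ^+ 2)) eqkl /=.
set s := part_sum c' y k in eqkl *; set t := part_sum c' y l in eqkl *.
have -> : t = part_sum c x k + part_sum c x l - s by rewrite -eqkl; ring.
ring.
Qed.

(** The tangent inequality at [u], summed over the part. *)
Lemma pmass_part_ge (p : R) c x k (u : R) : 1 < p ->
  (forall i, 0 <= x 0 i) -> 0 <= u ->
  p * part_sum c x k * u `^ (p - 1) - #|[pred i | c i == k]|%:R * ((p - 1) * u `^ p)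
    <= \sum_(i | c i == k) `|x 0 i| `^ p.
Proof.
move=> p1 x0 u0; rewrite lerBlDr -sum1_card natr_sum big_distrl -big_split /=.
rewrite /part_sum big_distrr big_distrl; apply: ler_sum => i _ /=.
by rewrite ger0_norm // mul1r powR_tangent_le.
Qed.

Lemma pmass_part_gt (p : R) c x k (u : R) (j : 'I_n) : 1 < p ->
  (forall i, 0 <= x 0 i) -> 0 <= u -> c j = k -> x 0 j != u ->
  p * part_sum c x k * u `^ (p - 1) - #|[pred i | c i == k]|%:R * ((p - 1) * u `^ p)
    < \sum_(i | c i == k) `|x 0 i| `^ p.
Proof.
move=> p1 x0 u0 cj xj; rewrite ltrBlDr -sum1_card natr_sum big_distrl -big_split /=.
rewrite /part_sum big_distrr big_distrl (bigD1 j) ?cj //= [ltRHS](bigD1 j) ?cj //=.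
apply: ltr_leD; first by rewrite ger0_norm // mul1r powR_tangent_lt.
by apply: ler_sum => i _; rewrite ger0_norm // mul1r powR_tangent_le.
Qed.

Lemma sum_two_parts c (k l : T) (F : 'I_n -> R) : k != l ->
  \sum_i F i = \sum_(i | c i == k) F i + \sum_(i | c i == l) F i
    + \sum_(i | (c i != k) && (c i != l)) F i.
Proof.
move=> kl; rewrite (bigID (fun i => c i == k)) /= -addrA; congr (_ + _).
rewrite (bigID (fun i => c i == l)) /=; congr (_ + _); apply: eq_bigl => i.
by case: (eqVneq (c i) l) => [->|]; rewrite ?andbF // eq_sym kl.
Qed.

(** [v] passes from part [k] to part [l], and the new parts get constant weights [X] and [Y]. The
    hypothesis keeps the joint part sum, so the exchange formula applies. *)
Lemma move_vertex (p : R) c x (k l : T) (v : 'I_n) (X Y : R) :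
  k != l -> c v = k -> 0 <= X -> 0 <= Y -> (forall i, 0 <= x 0 i) ->
  let a := #|[pred i | c i == k]|%:R in
  let b := #|[pred i | c i == l]|%:R in
  (a - 1) * X + (b + 1) * Y = part_sum c x k + part_sum c x l ->
  exists c' y, [/\ forall i, 0 <= y 0 i,
    edge_form (multipartite c') y = edge_form (multipartite c) x
      + 2 * ((a - 1) * X * ((b + 1) * Y) - part_sum c x k * part_sum c x l) &
    pmass p y + (\sum_(i | c i == k) `|x 0 i| `^ p + \sum_(i | c i == l) `|x 0 i| `^ p)
     = pmass p x + ((a - 1) * X `^ p + (b + 1) * Y `^ p)].
Proof.
move=> kl cv X0 Y0 x0 a b sumXY.
pose c' u := if u == v then l else c u.
pose f u := if c' u == k then X else if c' u == l then Y else x 0 u.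
have c'k : #|[pred i | c' i == k]|%:R = a - 1 :> R.
  rewrite /a [in RHS](cardD1 v) inE cv eqxx natrD addrC addKr; congr (_%:R).
  by apply: eq_card => u; rewrite !inE /c'; case: (u == v); rewrite //= eq_sym (negbTE kl).
have c'l : #|[pred i | c' i == l]|%:R = b + 1 :> R.
  rewrite /b (cardD1 v) inE /c' eqxx eqxx natrD addrC; congr (_%:R + _).
  apply: eq_card => u; rewrite !inE; case: (eqVneq u v) => [->|] //=.
  by rewrite cv (negbTE kl).
have sk : part_sum c' (\row_i f i) k = (a - 1) * X.
  rewrite -c'k -sum1_card natr_sum big_distrl; apply: eq_bigr => u cu /=.
  by rewrite mxE /f cu mul1r.
have sl : part_sum c' (\row_i f i) l = (b + 1) * Y.
  rewrite -c'l -sum1_card natr_sum big_distrl; apply: eq_bigr => u cu /=.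
  by rewrite mxE /f (eqP cu) eq_sym (negbTE kl) eqxx mul1r.
have sm m : m != k -> m != l -> part_sum c' (\row_i f i) m = part_sum c x m.
  move=> mk ml; apply: eq_big => [u|u /eqP cu].
    rewrite /c'; case: (eqVneq u v) => [->|//]; rewrite cv.
    by rewrite (eq_sym l) (eq_sym k) (negbTE mk) (negbTE ml).
  by rewrite mxE /f cu (negbTE mk) (negbTE ml).
exists c', (\row_i f i); split.
- by move=> i; rewrite mxE /f; do 2 case: ifP => // _.
- by rewrite (edge_form_part_sum_exchange kl sm) ?sk ?sl.
rewrite /pmass (sum_two_parts c' _ kl) (sum_two_parts c (fun i => `|x 0 i| `^ p) kl).
rewrite (_ : \sum_(i | c' i == k) _ = (a - 1) * X `^ p); last first.
  rewrite -c'k -sum1_card natr_sum big_distrl; apply: eq_bigr => u cu /=.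
  by rewrite mxE /f cu mul1r ger0_norm.
rewrite (_ : \sum_(i | c' i == l) _ = (b + 1) * Y `^ p); last first.
  rewrite -c'l -sum1_card natr_sum big_distrl; apply: eq_bigr => u cu /=.
  by rewrite mxE /f (eqP cu) eq_sym (negbTE kl) eqxx mul1r ger0_norm.
rewrite (_ : \sum_(i | (c' i != k) && (c' i != l)) _ =
  \sum_(i | (c i != k) && (c i != l)) `|x 0 i| `^ p); first by ring.
apply: eq_big => [u|u /andP[cuk cul]].
  by rewrite /c'; case: (eqVneq u v) => [->|//]; rewrite cv !eqxx andbF.
by rewrite mxE /f (negbTE cuk) (negbTE cul).
Qed.

(** * Colourings and weightings that are jointly optimal *)

Section Optimal.
Variables (p M : R) (c : 'I_n -> T) (x : 'rV[R]_n).
Hypotheses (n0 : (0 < n)%N) (p1 : 1 < p) (M0 : 0 < M).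
Hypothesis radius_le : forall c', pspectral_radius p (multipartite c') <= M.
Hypotheses (x0 : forall i, 0 <= x 0 i) (xm : pmass p x = 1).
Hypothesis (xM : edge_form (multipartite c) x = M).

Let p0 : 0 < p. Proof. by apply: lt_trans p1. Qed.

Lemma optimal_form_le c' y : pmass p y <= 1 -> edge_form (multipartite c') y <= M.
Proof. by move=> ym; apply: le_trans (radius_le c'); exact: edge_form_le_of_pmass_le1. Qed.

(** With p-mass below 1, rescaling to the sphere would push the form above [M], as [M] is
    positive. *)
Lemma optimal_mass_ge c' y : edge_form (multipartite c') y = M -> 1 <= pmass p y.
Proof.
move=> yM; rewrite leNgt; apply/negP => ym.
have := lt_le_trans (edge_form_lt_of_pmass_lt1 n0 p0 (G := multipartite c') _ ym) (radius_le c').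
by rewrite yM ltxx => /(_ M0).
Qed.

(* If [x 0 i = 0], recolouring [i] does not change the form; give [i] the colour
   of some [j] with [x 0 j > 0] and split the weight of [j] evenly between them. *)
Lemma optimal_gt0 i : 0 < x 0 i.
Proof.
rewrite lt_neqAle x0 andbT eq_sym; apply/eqP => xi.
have [j xj] : exists j, 0 < x 0 j.
  apply: contrapT => /forallNP xle.
  have x00 : pmass p x = 0.
    apply: big1 => j _; have -> : x 0 j = 0.
      by apply/eqP; rewrite eq_le x0 andbT leNgt; apply/negP.
    by rewrite normr0 powR0 // gt_eqF.
  by move: xm; rewrite x00 => /esym/eqP; rewrite oner_eq0.
have ji : j != i by apply: contraTneq xj => ->; rewrite xi ltxx.
pose c' u := if u == i then c j else c u.
pose f u := if (u == i) || (u == j) then x 0 j / 2 else x 0 u.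
have fE u : u != i -> u != j -> f u = x 0 u by rewrite /f => /negbTE -> /negbTE ->.
have fi : f i = x 0 j / 2 by rewrite /f eqxx.
have fj : f j = x 0 j / 2 by rewrite /f eqxx orbT.
have sE k : part_sum c' (\row_u f u) k = part_sum c x k.
  rewrite /part_sum big_mkcond [RHS]big_mkcond /=.
  rewrite (bigD1 i) // [RHS](bigD1 i) //= (bigD1 j) //= [X in _ = _ + X](bigD1 j) //= !addrA.
  congr (_ + _); last first.
    by apply: eq_bigr => u /andP[ui uj]; rewrite mxE fE // /c' (negbTE ui).
  by rewrite /c' !mxE eqxx (negbTE ji) fi fj xi; case: ifP => _; case: ifP => _; lra.
have formE : edge_form (multipartite c') (\row_u f u) = M.
  by rewrite -xM !edge_form_multipartite !(eq_bigr _ (fun k _ => sE k)) //;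
     congr (_ - _); apply: eq_bigr => k _; rewrite sE.
have := optimal_mass_ge formE; rewrite leNgt => /negP; apply.
rewrite -xm /pmass (bigD1 i) // [ltRHS](bigD1 i) //= (bigD1 j) //= [X in _ < _ + X](bigD1 j) //= !addrA.
rewrite (_ : \sum_(u | (u != i) && (u != j)) `|(\row_u f u) 0 u| `^ p
   = \sum_(u | (u != i) && (u != j)) `|x 0 u| `^ p); last first.
  by apply: eq_bigr => u /andP[ui uj]; rewrite mxE fE.
rewrite ltrD2r !mxE fi fj xi normr0 powR0 ?gt_eqF // add0r.
have h0 : 0 < x 0 j / 2 by rewrite divr_gt0.
rewrite !ger0_norm ?ltW //.
(* With [h = x 0 j / 2], the tangent at [h] gives [(p + 1) * h^p <= (2 * h)^p], and [2 < p + 1]. *)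
have := @powR_tangent_le R p (x 0 j) (x 0 j / 2) p1 (ltW xj) (ltW h0).
rewrite (powR_mulr_sub1 p1 (ltW h0)).
have : 0 < (p - 1) * (x 0 j * (x 0 j / 2) `^ (p - 1)).
  by rewrite !mulr_gt0 ?powR_gt0 ?subr_gt0.
set q := _ `^ (p - 1); lra.
Qed.

(* Otherwise move a vertex of [k] to [l], with constant weights [X] and [Y] on the new
   parts.  If keeping the part sums [s] and [t] gives [X <= Y], the p-mass drops;
   if not, equal weights [m] with the same total [s + t] increase the form. *)
Lemma optimal_balanced (k l : T) :
  (#|[pred i | c i == k]| <= (#|[pred i | c i == l]|).+1)%N.
Proof.
rewrite leqNgt; apply/negP => lk.
have kl : k != l by apply: contraTneq lk => ->; rewrite -leqNgt.
have [v /eqP cv] : exists v, c v == k.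
  have /card_gt0P[v] : (0 < #|[pred i | c i == k]|)%N by exact: leq_trans lk.
  by rewrite inE; exists v.
pose a : R := #|[pred i | c i == k]|%:R; pose b : R := #|[pred i | c i == l]|%:R.
have b0 : 0 <= b by rewrite ler0n.
have ab : b + 2 <= a by rewrite /a /b -natrD ler_nat addn2.
pose s := part_sum c x k; pose t := part_sum c x l.
have s0 : 0 < s.
  rewrite /s /part_sum (bigD1 v) ?cv //= ltr_pwDl ?optimal_gt0 //.
  by apply: sumr_ge0 => i _.
have t0 : 0 <= t by apply: sumr_ge0.
have powE u : 0 < u -> u `^ p = u * u `^ (p - 1).
  by move=> u0; rewrite powR_mulr_sub1 // ltW.
have [st|st] := leP (s * (b + 1)) (t * (a - 1)).
  pose X := s / (a - 1); pose Y := t / (b + 1).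
  have X0 : 0 < X by rewrite divr_gt0 //; lra.
  have XY : X <= Y by rewrite ler_pdivrMr 1?mulrAC ?ler_pdivlMr //; lra.
  have Y0 : 0 < Y by exact: lt_le_trans XY.
  have aX : (a - 1) * X = s by rewrite /X mulrC divfK // gt_eqF //; lra.
  have bY : (b + 1) * Y = t by rewrite /Y mulrC divfK // gt_eqF //; lra.
  have [|c' [y [y0 yf ym]]] := @move_vertex p c x k l v X Y kl cv (ltW X0) (ltW Y0) x0.
    by rewrite -/a -/b aX bY.
  move: yf ym; rewrite -/a -/b aX bY -/s -/t subrr mulr0 addr0 xM xm => yf ym.
  have := optimal_mass_ge yf.
  (* Constant weight [X] on all of part [k] would give [s = a * X], against [s = (a - 1) * X] with
     [X > 0]. This makes the tangent bound strict. *)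
  have [j cj xj] : exists2 j, c j = k & x 0 j != X.
    apply: contrapT => /forall2NP xX; have : s = a * X.
      rewrite /s /part_sum /a -sum1_card natr_sum big_distrl; apply: eq_bigr => i /eqP ci /=.
      by rewrite mul1r; case: (xX i) => // /negP; rewrite negbK => /eqP.
    by rewrite -aX; lra.
  have := pmass_part_gt p1 x0 (ltW X0) cj xj.
  have := @pmass_part_ge p c x l Y p1 x0 (ltW Y0).
  rewrite -/a -/b -/s -/t -aX -bY.
  have : X `^ p <= Y `^ p by apply: ge0_ler_powR; rewrite ?nnegrE // ltW.
  move: ym; rewrite !powE //; set P := X `^ _; set Q := Y `^ _.
  set A := \sum_(i | c i == k) _; set B := \sum_(i | c i == l) _.
  move=> ym PQ hB hA ym1.
  (* The tangent bounds read [A > (a - p) * X^p] and [B >= (b + p) * Y^p], so the new p-mass is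
     below [1 - (p - 1) * (Y^p - X^p)]. *)
  have : 0 <= (p - 1) * (Y * Q - X * P) by rewrite mulr_ge0 ?subr_ge0 // ltW.
  lra.
pose m := (s + t) / (a + b).
have m0 : 0 < m by rewrite divr_gt0 //; lra.
have mE : (a + b) * m = s + t by rewrite /m mulrC divfK // gt_eqF //; lra.
have [|c' [y [y0 yf ym]]] := @move_vertex p c x k l v m m kl cv (ltW m0) (ltW m0) x0.
  by rewrite -/a -/b -/s -/t -mE; ring.
move: yf ym; rewrite -/a -/b -/s -/t xM xm => yf ym.
(* The tangents at the common mean [m] bound the old mass of the two parts below by [(a + b) * m^p],
   which is their new mass. *)
have : pmass p y <= 1.
  have := @pmass_part_ge p c x k m p1 x0 (ltW m0).
  have := @pmass_part_ge p c x l m p1 x0 (ltW m0).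
  rewrite -/a -/b -/s -/t.
  move: ym; rewrite !powE //; set P := m `^ _.
  set A := \sum_(i | c i == k) _; set B := \sum_(i | c i == l) _.
  have : p * P * ((a + b) * m) = p * P * (s + t) by rewrite mE.
  lra.
move=> /(optimal_form_le c'); rewrite yf gerDl pmulr_rle0 // subr_le0.
apply/negP; rewrite -ltNge.
(* With [d = s - (a - 1) * m], positive in this case, the product of the two part sums rises by
   [d^2 + d * (a - b - 2) * m > 0]. *)
have d0 : 0 < s - (a - 1) * m.
  have : (a - 1) * m * (a + b) < s * (a + b).
    have -> : (a - 1) * m * (a + b) = (a - 1) * (s + t) by rewrite -mE; ring.
    lra.
  by rewrite ltr_pM2r ?subr_gt0 //; lra.
have tE : t = (b + 1) * m - (s - (a - 1) * m) by rewrite -[t](addKr s) -mE; ring.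
have := mulr_gt0 d0 d0.
have : 0 <= (s - (a - 1) * m) * ((a - b - 2) * m).
  by rewrite mulr_ge0 ?(ltW d0) // mulr_ge0 ?(ltW m0) //; lra.
rewrite tE; lra.
Qed.

End Optimal.
End Multipartite.

(** * From cliques to colourings, and comparison with the Turán graph *)

Lemma leq_clique_number (n : nat) (G : sgraph n) (A : {set 'I_n}) :
  clique G A -> (#|A| <= clique_number G)%N.
Proof. exact: (@leq_bigmax_cond _ (clique G) (fun A => #|A|)). Qed.

Lemma clique_number_gt0 (n : nat) (G : sgraph n) : (0 < n)%N -> (0 < clique_number G)%N.
Proof.
move=> n0; rewrite -(cards1 (Ordinal n0)); apply: leq_clique_number.
by apply/cliqueP => i j /set1P -> /set1P ->; rewrite eqxx.
Qed.

(** Here the clique number is 1, and modulo 1 all vertices lie in one part. This case is split off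
    because the joint maximum has to be positive. *)
Lemma isomorphic_turan_edgeless (n : nat) (G : sgraph n) : (0 < n)%N ->
  (forall i j, ~~ G i j) -> isomorphic G (turan (clique_number G) n).
Proof.
move=> n0 noG; have -> : clique_number G = 1%N.
  apply/eqP; rewrite eqn_leq clique_number_gt0 // andbT.
  apply/bigmax_leqP => A /cliqueP cl; apply/card_le1_eqP => i j iA jA.
  by apply/eqP; apply: contraNT (noG j i); exact: cl.
by exists 1%g => i j; rewrite /= /turan_adj !modn1 (negbTE (noG i j)).
Qed.

(** Degree majorization on the whole vertex set. The colouring is a finite function so that a best
    one can be chosen among finitely many. *)
Lemma multipartite_majorization (R : realType) (n : nat) (G : sgraph n) (k : nat)
    (x : 'rV[R]_n) : (clique_number G <= k.+1)%N -> (forall i, 0 <= x 0 i) ->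
  exists c : {ffun 'I_n -> 'I_k.+1},
    edge_form G x <= edge_form (multipartite c) x /\
    ((forall i, 0 < x 0 i) -> edge_form (multipartite c) x <= edge_form G x ->
     G =2 multipartite c).
Proof.
move=> Gk x0; have [|c [ck cle ceq]] :=
  @weighted_degree_majorization R n G (x 0) k.+1 [set: 'I_n]%SET x0.
  by move=> C _ /leq_clique_number Ck; exact: leq_trans Gk.
pose d := [ffun i => inord (c i) : 'I_k.+1].
have dE i j : (d i != d j) = (c i != c j).
  by rewrite !ffunE -(inj_eq val_inj) /= !inordK // ck ?finset.inE.
have GE (P : rel 'I_n) : \sum_(i in [set: 'I_n]%SET) \sum_(j in [set: 'I_n]%SET | P i j) x 0 i * x 0 j
    = \sum_i \sum_(j | P i j) x 0 i * x 0 j.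
  by apply: eq_big => [i|i _]; rewrite ?finset.inE //; apply: eq_bigl => j; rewrite finset.inE.
have dF : edge_form (multipartite d) x = \sum_i \sum_(j | c i != c j) x 0 i * x 0 j.
  by rewrite edge_formE; apply: eq_bigr => i _; apply: eq_bigl => j; exact: dE.
exists d; rewrite dF edge_formE -!GE; split=> // xp le i j.
by rewrite ceq ?finset.inE // /= /multipartite_adj dE.
Qed.

Unset Implicit Arguments.
Set Strict Implicit.

Theorem theorem2 (R : realType) (p : R) (hp : 1 < p)
  (n omega : nat) (G : sgraph n) (homega : clique_number G = omega) :
  ~ isomorphic G (turan omega n) ->
  pspectral_radius p G < pspectral_radius p (turan omega n).
Proof.
have p0 : 0 < p by exact: lt_trans hp.
move=> niso; have [n_eq0|n0] := posnP n.
  by case: niso; exists 1%g => -[i i_lt]; exfalso; rewrite n_eq0 in i_lt.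
have [i [j Gij]] : exists i j, G i j.
  apply: contrapT => noG; apply: niso; rewrite -homega.
  apply: isomorphic_turan_edgeless => // i j; apply/negP => Gij.
  by apply: noG; exists i, j.
have := clique_number_gt0 G n0; rewrite homega; case: omega homega niso => // k Gk niso _.
pose radius (c : {ffun 'I_n -> 'I_k.+1}) := pspectral_radius p (multipartite c).
(* The constant colouring only shows that there is something to maximise over. *)
pose c0 := [arg max_(c > [ffun=> ord0] : {ffun 'I_n -> 'I_k.+1}) radius c]%O.
have c0max c : radius c <= radius c0.
  by rewrite /c0; case: Order.TotalTheory.arg_maxP => // c' _; apply.
have rad_le (c' : 'I_n -> 'I_k.+1) : pspectral_radius p (multipartite c') <= radius c0.
  apply: le_trans (c0max (finfun c')); apply: isomorphic_pspectral_radius_le => //.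
  by exists 1%g => u v; rewrite /= /multipartite_adj !perm1 !ffunE.
have [x [x0 xm xG]] := pspectral_radius_nonneg_max n0 p0 G.
have [|c [cle ceq]] := @multipartite_majorization R n G k x _ x0; first by rewrite Gk.
have cM : edge_form (multipartite c) x <= radius c.
  by apply: edge_form_le_of_pmass_le1; rewrite ?xm.
have M0 : 0 < radius c0.
  apply: lt_le_trans (pspectral_radius_gt0 n0 p0 Gij) _.
  by rewrite -xG (le_trans cle) // (le_trans cM).
have [y [y0 ym yM]] := pspectral_radius_nonneg_max n0 p0 (multipartite c0).
(* [c0] with its maximiser [y] is jointly optimal, hence balanced. *)
have c0T : isomorphic (multipartite c0) (turan k.+1 n).
  by apply: balanced_isomorphic_turan => u v; exact: (optimal_balanced n0 hp M0 rad_le y0 ym yM).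
apply: lt_le_trans (isomorphic_pspectral_radius_le n0 p0 c0T).
rewrite ltNge; apply/negP => GM; apply: niso.
(* If the radius of [G] reached [radius c0], the chain [radius c0 <= edge_form G x <= edge_form
   (multipartite c) x <= radius c <= radius c0] would collapse. Then [c] with [x] is jointly optimal
   as well, so [x] is positive, [c] is balanced, and the equality case identifies [G] with
   [multipartite c]. *)
have cx : edge_form (multipartite c) x = radius c0.
  apply/eqP; rewrite eq_le (le_trans cM (rad_le c)) /=.
  by rewrite (le_trans GM) // -xG.
have xp := optimal_gt0 n0 hp M0 rad_le x0 xm cx.
have [s sP] : isomorphic (multipartite c) (turan k.+1 n).
  by apply: balanced_isomorphic_turan => u v; exact: (optimal_balanced n0 hp M0 rad_le x0 xm cx).
by exists s => u v; rewrite ceq // cx xG.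
Qed.
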